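(* Let $(a_n)_{n\ge1}$ be any positive sequence satisfying $a_n\to\infty$ and $a_n/\sqrt n\to0$. Then $\frac{\log q_n-n}{a_n\sqrt n}$ satisfies on $\mathbb R$ a moderate deviation principle with speed $a_n^2$ and good rate function $I(x)=\frac{x^2}{2}$, $x\in\mathbb R$. Equivalently, for every Borel set $B\subset\mathbb R$, $$-\inf_{x\in B^\circ}\frac{x^2}{2}\le\liminf_{n\to\infty}\frac1{a_n^2}\log\mathbb P\left(\frac{\log q_n-n}{a_n\sqrt n}\in B\right)\le\limsup_{n\to\infty}\frac1{a_n^2}\log\mathbb P\left(\frac{\log q_n-n}{a_n\sqrt n}\in B\right)\le-\inf_{x\in\overline B}\frac{x^2}{2}.$$
   Context: Every $x\in(0,1)$ has a unique (infinite) Engel expansion $x=\frac1{q_1}+\frac1{q_1q_2}+\cdots+\frac1{q_1q_2\cdots q_n}+\cdots$ with integer digits $q_n=q_n(x)$ satisfying $q_{n+1}\ge q_n\ge2$. The expanded number is taken uniformly distributed on $(0,1)$, which makes the $q_n$ random variables. It is known that $(q_n)_{n\ge1}$ is then a time-homogeneous Markov chain on $\{2,3,\ldots\}$ with transition probabilities $\mathbb P(q_n=k\mid q_{n-1}=j)=\frac{j-1}{k(k-1)}$ for $k\ge j\ge2$, and initial distribution $\mathbb P(q_1=k)=\frac1{k(k-1)}$, $k\ge2$. $B^\circ$ and $\overline B$ denote the interior and closure of $B$ in $\mathbb R$; conventions: $\inf\emptyset=+\infty$ and $\log 0=-\infty$. *)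

(* Defs.v *)
From HB Require Import structures.
From mathcomp Require Import all_boot all_order all_algebra.
From mathcomp Require Import all_classical all_reals all_analysis.
From mathcomp Require Import ring lra.
Import Order.TTheory GRing.Theory Num.Theory.
Import numFieldNormedType.Exports.

Set Implicit Arguments.
Unset Strict Implicit.
Unset Printing Implicit Defensive.

Local Open Scope classical_set_scope.
Local Open Scope ring_scope.

(** Digit sequences are 0-based here: [q k] stands for the digit q_(k+1). *)
Definition engel_term (R : realType) (q : nat -> nat) (n : nat) : R :=
  (\prod_(k < n.+1) (q k)%:R)^-1.

Definition engel_expansion (R : realType) (x : R) (q : nat -> nat) : Prop :=
  [/\ (forall k, (2 <= q k)%N), (forall k, (q k <= q k.+1)%N)
    & series (@engel_term R q) @ \oo --> x].

(** 1-based: [engel_digit x n] is q_n(x) for n >= 1 (and q_1(x) when n = 0).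
    By [engel_expansion_ex] and [engel_expansion_uniq] the choice is the unique
    infinite Engel expansion when x is in (0, 1). *)
Definition engel_digit (R : realType) (x : R) (n : nat) : nat :=
  xget (fun=> 2%N) [set q | engel_expansion x q] n.-1.

Definition good_rate_function (R : realType) (I : R -> \bar R) : Prop :=
  [/\ (forall x, 0 <= I x)%E, lower_semicontinuous I
    & forall c : R, compact [set x | (I x <= c%:E)%E]].

Definition ldp_bounds (d : measure_display) (T : measurableType d)
    (R : realType) (P : probability T R) (Z : nat -> T -> R) (s : nat -> R)
    (I : R -> \bar R) (B : set R) : Prop :=
  let u := fun n => ((s n)^-1%:E * lne (P (Z n @^-1` B)))%E in
  [/\ (- ereal_inf [set I x | x in B°] <= limn_einf u)%E,
      (limn_einf u <= limn_esup u)%E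
    & (limn_esup u <= - ereal_inf [set I x | x in closure B])%E].

Definition satisfies_ldp (d : measure_display) (T : measurableType d)
    (R : realType) (P : probability T R) (Z : nat -> T -> R) (s : nat -> R)
    (I : R -> \bar R) : Prop :=
  good_rate_function I /\ forall B : set R, measurable B -> ldp_bounds P Z s I B.

Lemma engel_series_recl (R : realType) (q : nat -> nat) n :
  series (@engel_term R q) n.+1 =
  (q 0)%:R^-1 * (1 + series (@engel_term R (q \o succn)) n).
Proof.
rewrite /series/= big_nat_recl//= {1}/engel_term big_ord_recl big_ord0 mulr1.
rewrite mulrDr mulr1; congr (_ + _); rewrite big_distrr/=.
by apply: eq_bigr => i _; rewrite /engel_term big_ord_recl invfM.
Qed.

Lemma engel_expansion_tail (R : realType) (x : R) q : engel_expansion x q ->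
  engel_expansion ((q 0)%:R * x - 1) (q \o succn).
Proof.
case=> q2 qn xq; split => [k|k|]; [exact: q2|exact: qn|].
have q0 : (q 0)%:R != 0 :> R by rewrite pnatr_eq0 -lt0n (leq_trans _ (q2 0)).
have -> : series (@engel_term R (q \o succn)) =
    (fun n => (q 0)%:R * series (@engel_term R q) n.+1 - 1).
  by apply/funext => n; rewrite engel_series_recl mulVKf// addrC addKr.
apply: cvgB; last exact: cvg_cst.
apply: cvgM; first exact: cvg_cst.
by rewrite (cvg_shiftS (series (@engel_term R q))).
Qed.

Lemma engel_series_le (R : realType) q n : (forall k, 2 <= q k)%N ->
  (forall k, q k <= q k.+1)%N ->
  series (@engel_term R q) n <= ((q 0)%:R - 1)^-1.
Proof.
elim: n q => [|n IH] q q2 qn.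
  by rewrite /series/= big_geq// invr_ge0 subr_ge0 ler1n ltnW.
have a2 : 2 <= (q 0)%:R :> R by rewrite ler_nat.
have ab : (q 0)%:R <= (q 1)%:R :> R by rewrite ler_nat.
rewrite engel_series_recl.
have := IH (q \o succn) (fun k => q2 k.+1) (fun k => qn k.+1); rewrite /=.
set s := series _ _ => sq.
have sq0 : s <= ((q 0)%:R - 1)^-1 by rewrite (le_trans sq)// lef_pV2 ?posrE; lra.
rewrite mulrC ler_pdivrMr; last lra.
apply: (@le_trans _ _ (1 + ((q 0)%:R - 1)^-1)); first lra.
rewrite -[X in X + _](@mulVf _ ((q 0)%:R - 1)); last by rewrite gt_eqF//; lra.
by rewrite -[X in _ + X]mulr1 -mulrDr subrK.
Qed.

Lemma engel_expansion_bounds (R : realType) (x : R) q : engel_expansion x q ->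
  (q 0)%:R^-1 < x <= ((q 0)%:R - 1)^-1.
Proof.
case=> q2 qn xq; apply/andP; split; last first.
  rewrite -(cvg_lim _ xq)//; apply: limr_le; first by apply/cvg_ex; exists x.
  by near=> n; exact: engel_series_le.
have tp k : 0 < @engel_term R q k.
  rewrite invr_gt0 prodr_gt0// => i _.
  by rewrite ltr0n (leq_trans _ (q2 i)).
have ndq : nondecreasing_seq (series (@engel_term R q)).
  by apply/nondecreasing_seqP => n; rewrite /series/= big_nat_recr//= lerDl ltW.
have := nondecreasing_cvgn_le ndq (cvgP _ xq) 2.
rewrite (cvg_lim _ xq)//; apply: lt_le_trans.
by rewrite /series/= !big_nat_recr//= big_geq// add0r
  {1}/engel_term big_ord_recl big_ord0 mulr1 ltrDl.
Unshelve. all: by end_near. Qed.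

Lemma engel_expansion_first (R : realType) (x : R) q : engel_expansion x q ->
  q 0 = (Num.truncn x^-1).+1.
Proof.
move=> xq; have [q2 _ _] := xq; have /andP[lx xu] := engel_expansion_bounds xq.
have a2 : 2 <= (q 0)%:R :> R by rewrite ler_nat.
have x0 : 0 < x by rewrite (lt_trans _ lx)// invr_gt0; lra.
have [m qE] : exists m, q 0 = m.+1 by case: (q 0) (q2 0) => // m _; exists m.
have m0 : 0 < m%:R :> R by move: a2; rewrite qE -natr1; lra.
move: lx xu; rewrite qE -[in X in _ -> X -> _]natr1 addrK => lx xu.
congr _.+1; apply/esym/eqP; rewrite truncn_eq ?invr_ge0 ?(ltW x0)//.
by rewrite -[m%:R]invrK lef_pV2 ?posrE ?invr_gt0// xu invf_plt ?posrE.
Qed.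

Lemma engel_expansion_uniq (R : realType) (x : R) q q' :
  engel_expansion x q -> engel_expansion x q' -> q = q'.
Proof.
move=> xq xq'; apply/funext => n; elim: n x q q' xq xq' => [|n IH] x q q' xq xq'.
  by rewrite (engel_expansion_first xq) (engel_expansion_first xq').
have qq' : q 0 = q' 0.
  by rewrite (engel_expansion_first xq) (engel_expansion_first xq').
apply: (IH _ (q \o succn) (q' \o succn) (engel_expansion_tail xq)).
by rewrite qq'; exact: engel_expansion_tail.
Qed.

Lemma engel_step_itv (R : realType) (x : R) : 0 < x ->
  0 < (Num.truncn x^-1).+1%:R * x - 1 <= x.
Proof.
move=> x0; have /truncn_itv/andP[t1 t2] : 0 <= x^-1 by rewrite invr_ge0 ltW.
rewrite subr_gt0 -ltr_pdivrMr// div1r t2/= -natr1 mulrDl mul1r.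
move: t1; rewrite -div1r ler_pdivlMr//; lra.
Qed.

Lemma engel_expansion_ex (R : realType) (x : R) : 0 < x < 1 ->
  exists q, engel_expansion x q.
Proof.
pose t (y : R) := (Num.truncn y^-1).+1%:R * y - 1.
pose q (y : R) n := (Num.truncn (iter n t y)^-1).+1.
have tq y : q (t y) = q y \o succn.
  by apply/funext => n; rewrite /q /= -iterS iterSr.
have tgt0 n y : 0 < y -> 0 < iter n t y.
  by move=> y0; elim: n => //= n /engel_step_itv/andP[].
have tle n y : 0 < y -> iter n.+1 t y <= iter n t y.
  by move=> y0; have /engel_step_itv/andP[] := tgt0 n y y0.
move=> /andP[x0 x1]; have q2 y k : 0 < y <= 1 -> (2 <= q y k)%N.
  move=> /andP[y0 y1]; rewrite ltnS truncn_gt0 invf_ge1 ?tgt0//.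
  by elim: k => //= k; apply: le_trans; exact: tle.
have le2 n : forall y, 0 < y <= 1 ->
    0 <= y - series (@engel_term R (q y)) n <= 2^-1 ^+ n.
  elim: n => [|n IH] y /andP[y0 y1].
    by rewrite /series/= big_geq// subr0 expr0 y1 ltW.
  have /andP[ty0 ty] := engel_step_itv y0.
  have a2 : 2 <= (q y 0)%:R :> R by rewrite ler_nat q2// y0.
  have /IH : 0 < t y <= 1 by rewrite ty0 (le_trans ty).
  rewrite engel_series_recl -tq; set s := series _ _ => /andP[s0 s1].
  have -> : y - (q y 0)%:R^-1 * (1 + s) = (q y 0)%:R^-1 * (t y - s).
    have -> : t y = (q y 0)%:R * y - 1 by [].
    by field; lra.
  rewrite mulr_ge0 ?invr_ge0//= exprS ler_pM ?invr_ge0//.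
  by rewrite lef_pV2 ?posrE//; lra.
exists (q x); split=> [k|k|].
- by rewrite q2// x0 ltW.
- by rewrite ltnS le_truncn// lef_pV2 ?posrE ?tgt0// tle.
have h : (fun n => x - series (@engel_term R (q x)) n) @ \oo --> (0 : R).
  apply: (@squeeze_cvgr _ _ _ _ (cst 0) (GRing.exp 2^-1)).
  - by apply: nearW => n; apply: le2; rewrite x0 ltW.
  - exact: cvg_cst.
  - by apply: cvg_expr; rewrite ger0_norm; lra.
have -> : series (@engel_term R (q x)) =
    (fun n => x - (x - series (@engel_term R (q x)) n)).
  by apply/funext => n; rewrite subKr.
by rewrite -[X in _ --> X]subr0; apply: cvgB h; exact: cvg_cst.
Qed.

(* Main.v *)
Require Import Defs.
From HB Require Import structures.
From mathcomp Require Import all_boot all_order all_algebra.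
From mathcomp Require Import all_classical all_reals all_analysis.
From mathcomp Require Import measurable_realfun.
From mathcomp Require Import ring lra.
Import Order.TTheory GRing.Theory Num.Theory.
Import numFieldNormedType.Exports.

(** The Engel chain has explicit eigenfunctions.  For [|t| <= 1/2] put
    [f_t(q) = \prod_(1 <= i <= q - 2) (1 + t / i)].  Writing [p(j, k)] for the
    transition probability [(j - 1) / (k (k - 1))], the sum
    [\sum_(k >= j) p(j, k) f_t(k)] telescopes to [f_t(j) / (1 - t)], so that
    the expectation of [f_t(q_n)] is exactly [(1 - t)^-n]
    ([engel_moment]).  No Markov property has to be established for this: the
    first digit is constant on [engel_cyl l], the Engel map [x |-> q_1 x - 1]
    is affine there with image [(0, 1/(l+1)]], and so the integral of
    [f_t(q_n)] over each interval [(0, 1/(m+1)]] is computed by induction on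
    [n] ([integral_engel_eigen]).

    The function [f_t(q)] agrees with [q^t] up to a factor between
    [e^(-4|t|)] and [e^(4|t|)] ([ln_engel_eigen_digit]), and
    [- ln (1 - t) = t + t^2/2 + O(|t|^3)] ([ln1B_expansion]).  Hence the
    expectation of [exp (t (log q_n - n))] is
    [exp (n t^2/2 + O(n |t|^3) + O(1))] ([engel_log_mgf]).  With
    [t a_n / sqrt n] in the place of [t], which tends to 0, the exponent
    becomes [a_n^2 (t^2/2 + o(1))]: at speed [a_n^2] the normalized variables
    have the limiting log-Laplace transform [t^2/2] of a standard Gaussian.

    That this implies the large deviation principle is the Gaussian case of
    the Gartner-Ellis theorem ([gartner_ellis_gaussian]).  Its upper bound is
    Chernoff's inequality on the two half-lines [|x| >= r].  Its lower bound
    near [x] weighs the probability by [exp (x s_n Z_n)]: by the same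
    inequality, the weighted mass outside [(x - h, x + h)] is exponentially
    smaller than the total. *)

Local Open Scope classical_set_scope.
Local Open Scope ring_scope.
Set Implicit Arguments.
Unset Strict Implicit.
Unset Printing Implicit Defensive.

(** * Upper and lower limits of extended real sequences *)

Section upper_lower_limits.
Context (R : realType).
Implicit Types (u : nat -> \bar R) (l : \bar R).
Local Open Scope ereal_scope.

Lemma limn_esup_le_near u l :
  (\forall n \near \oo, u n <= l) -> limn_esup u <= l.
Proof.
move=> ul; rewrite /limn_esup limf_esupE.
apply: (@le_trans _ _ (ereal_sup (u @` [set n | u n <= l]))).
  by apply: ereal_inf_lbound; exists [set n | u n <= l].
by apply: ge_ereal_sup => _ [n nl <-].
Qed.

Lemma limn_einf_ge_near u l :
  (\forall n \near \oo, l <= u n) -> l <= limn_einf u.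
Proof.
move=> ul; rewrite /limn_einf leeNr; apply: limn_esup_le_near.
by apply: filterS ul => n; rewrite leeN2.
Qed.

End upper_lower_limits.

(** * The Gaussian case of the Gartner-Ellis theorem *)

Section tilting.
Context (R : realType) (d : measure_display) (T : measurableType d).
Context (P : probability T R) (Y : T -> R) (mY : measurable_fun setT Y).

Lemma measurable_expR_scale (c : R) :
  measurable_fun setT (EFin \o (fun w => expR (c * Y w))).
Proof.
apply/measurable_EFinP; apply: measurableT_comp; first exact: measurable_expR.
exact: measurable_funM.
Qed.

(** Chernoff's inequality under an exponential weight: on [A] the extra factor
    [exp (e s (Y - r))] is at least 1.  With [t = 0] it bounds the probability
    of [A]; the sign of [e] selects the upper or the lower tail. *)
Lemma tilted_integral_le (A : set T) (t e s r : R) : measurable A -> 0 <= s ->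
  (forall w, A w -> 0 <= e * (Y w - r)) ->
  (\int[P]_(w in A) (expR (t * s * Y w))%:E <=
   (expR (- (e * s * r)))%:E * \int[P]_w (expR ((t + e) * s * Y w))%:E)%E.
Proof.
move=> mA s0 Ar.
rewrite -ge0_integralZl//; last exact: measurable_expR_scale.
apply: (@le_trans _ _ (\int[P]_(w in A)
    ((expR (- (e * s * r)))%:E * (expR ((t + e) * s * Y w))%:E))%E); last first.
  apply: ge0_subset_integral => //.
  by apply: emeasurable_funM => //; exact: measurable_expR_scale.
apply: ge0_le_integral => //.
- by apply: measurable_funTS; exact: measurable_expR_scale.
- apply: measurable_funTS; apply: emeasurable_funM => //.
  exact: measurable_expR_scale.
- move=> w Aw; rewrite -EFinM lee_fin -expRD ler_expR.
  have := mulr_ge0 s0 (Ar w Aw); nra.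
Qed.

End tilting.

(** The scaled cumulant generating function
    [(s n)^-1 log E(exp (t (s n) (Z n)))] tends to [t^2/2], written
    multiplicatively so that no logarithm of a possibly infinite integral
    occurs. *)
Definition gaussian_log_mgf (R : realType) (d : measure_display)
    (T : measurableType d) (P : probability T R) (Z : nat -> T -> R)
    (s : nat -> R) : Prop :=
  forall t e : R, 0 < e -> \forall n \near \oo,
    ((expR (s n * (t ^+ 2 / 2 - e)))%:E
     <= \int[P]_w (expR (t * s n * Z n w))%:E
     <= (expR (s n * (t ^+ 2 / 2 + e)))%:E)%E.

Section gartner_ellis.
Context (R : realType) (d : measure_display) (T : measurableType d).
Context (P : probability T R) (Z : nat -> T -> R) (s : nat -> R).
Context (mZ : forall n, measurable_fun setT (Z n)) (s_infty : s @ \oo --> +oo)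
  (mgfZ : gaussian_log_mgf P Z s).

Let s_gt0 : \forall n \near \oo, 0 < s n.
Proof. by move/cvgryPgt : s_infty; exact. Qed.

Lemma measurable_preimageZ n (B : set R) :
  measurable B -> measurable (Z n @^-1` B).
Proof. by move=> mB; rewrite -[X in measurable X]setTI; exact: mZ. Qed.

Lemma tilted_tail_le (t e r k : R) (B : set R) : 0 < k -> measurable B ->
  (forall x, B x -> 0 <= e * (x - r)) ->
  \forall n \near \oo,
    (\int[P]_(w in Z n @^-1` B) (expR (t * s n * Z n w))%:E <=
     (expR (s n * ((t + e) ^+ 2 / 2 + k - e * r)))%:E)%E.
Proof.
move=> k0 mB Br; near=> n.
have sn0 : 0 < s n by near: n.
have /andP[_ up] : ((expR (s n * ((t + e) ^+ 2 / 2 - k)))%:E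
    <= \int[P]_w (expR ((t + e) * s n * Z n w))%:E
    <= (expR (s n * ((t + e) ^+ 2 / 2 + k)))%:E)%E by near: n; exact: mgfZ.
have tl := @tilted_integral_le _ _ _ P _ (mZ n) (Z n @^-1` B) t e (s n) r
  (measurable_preimageZ _ mB) (ltW sn0) (fun w => Br (Z n w)).
apply: (le_trans tl).
apply: (@le_trans _ _ ((expR (- (e * s n * r)))%:E *
    (expR (s n * ((t + e) ^+ 2 / 2 + k)))%:E)%E).
  by rewrite lee_pmul2l// lte_fin expR_gt0.
rewrite -EFinM -expRD lee_fin ler_expR; nra.
Unshelve. all: by end_near. Qed.

(** The optimal tilts in Chernoff's inequality are [r] for the upper tail and
    [- r] for the lower one; both give the exponent [- r^2/2]. *)
Lemma prob_tail_le (r k : R) (B : set R) : 0 < k -> 0 <= r -> measurable B ->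
  (forall x, B x -> r <= `|x|) ->
  \forall n \near \oo,
    (P (Z n @^-1` B) <= (2 * expR (s n * (k - r ^+ 2 / 2)))%:E)%E.
Proof.
move=> k0 r0 mB Br.
have half (e : R) (C : set R) : measurable C -> e ^+ 2 = r ^+ 2 ->
    (forall x, C x -> 0 <= e * (x - e)) ->
    \forall n \near \oo,
      (P (Z n @^-1` C) <= (expR (s n * (k - r ^+ 2 / 2)))%:E)%E.
  move=> mC er Ce; apply: filterS (tilted_tail_le 0 k0 mC Ce) => n.
  under eq_integral do rewrite !mul0r expR0.
  rewrite integral_cst ?mul1e; last exact: measurable_preimageZ.
  move=> /le_trans; apply.
  rewrite lee_fin ler_expR add0r er -expr2 er; nra.
have mU : measurable (`[r, +oo[%classic : set R) by [].
have mD : measurable (`]-oo, - r]%classic : set R) by [].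
have hU := half r _ mU erefl _.
have hD := half (- r) _ mD (sqrrN r) _.
apply: filterS2 (hU _) (hD _).
- move=> n PU PD.
  apply: (@le_trans _ _ (P ((Z n @^-1` `[r, +oo[) `|` (Z n @^-1` `]-oo, -r])))).
    apply: le_measure; rewrite ?inE.
    - exact: measurable_preimageZ.
    - by apply: measurableU; exact: measurable_preimageZ.
    - move=> w /Br; rewrite ler_normr => /orP[h|h]; [left|right] => /=;
        rewrite in_itv/= ?andbT//; lra.
  apply: le_trans (measureU2 _ _ _) _; [exact: measurable_preimageZ..|].
  by rewrite mulr_natl mulr2n EFinD; exact: leeD.
- by move=> x /=; rewrite in_itv/= andbT => h; nra.
- by move=> x /=; rewrite in_itv/= => h; nra.
Qed.

(** Under the weight [exp (x s_n Z_n)] the total mass is about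
    [exp (s_n x^2/2)], while tilting by a further [h] or [- h] bounds the mass
    outside the ball by about [exp (s_n (x^2/2 - h^2/2))].  Half of the mass
    thus lies in the ball, where the weight is at most
    [exp (s_n (x^2 + |x| h))].  The tolerance in the three mass estimates is
    [h^2/8], a quarter of the gain [h^2/2]. *)
Lemma prob_ball_ge (x h : R) : 0 < h ->
  \forall n \near \oo,
   ((expR (- s n * (x ^+ 2 / 2 + h ^+ 2 / 8 + `|x| * h)) / 2)%:E
    <= P (Z n @^-1` `](x - h)%R, (x + h)%R[))%E.
Proof.
move=> h0.
have k0 : 0 < h ^+ 2 / 8 by apply: divr_gt0 => //; exact: exprn_gt0.
set B := `]x - h, x + h[%classic.
set U := `[x + h, +oo[%classic; set D := `]-oo, x - h]%classic.
have [mB mU mD] : [/\ measurable B, measurable U & measurable D].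
  by split; exact: measurable_itv.
near=> n.
have sn0 : 0 < s n by near: n.
have sn1 : 16 / h ^+ 2 <= s n.
  by near: n; move/cvgryPge : s_infty; exact.
have [hU hD] : (\int[P]_(w in Z n @^-1` U) (expR (x * s n * Z n w))%:E <=
    (expR (s n * ((x + h) ^+ 2 / 2 + h ^+ 2 / 8 - h * (x + h))))%:E)%E /\
   (\int[P]_(w in Z n @^-1` D) (expR (x * s n * Z n w))%:E <=
    (expR (s n * ((x + - h) ^+ 2 / 2 + h ^+ 2 / 8 - (- h) * (x - h))))%:E)%E.
  split; near: n; apply: tilted_tail_le => // y;
    rewrite /U /D /= in_itv/= ?andbT => ?; nra.
have /andP[lo _] : ((expR (s n * (x ^+ 2 / 2 - h ^+ 2 / 8)))%:E
    <= \int[P]_w (expR (x * s n * Z n w))%:E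
    <= (expR (s n * (x ^+ 2 / 2 + h ^+ 2 / 8)))%:E)%E by near: n; exact: mgfZ.
have hB : (\int[P]_(w in Z n @^-1` B) (expR (x * s n * Z n w))%:E <=
    (expR (s n * (x ^+ 2 + `|x| * h)))%:E * P (Z n @^-1` B))%E.
  rewrite -integral_cst; last exact: measurable_preimageZ.
  apply: ge0_le_integral => //.
  - exact: measurable_preimageZ.
  - by apply: measurable_funTS; apply: measurable_expR_scale.
  - move=> w; rewrite /B /= in_itv/= => /andP[w1 w2]; rewrite lee_fin ler_expR.
    rewrite mulrAC mulrC ler_wpM2l ?(ltW sn0)//.
    have : x * (Z n w - x) <= `|x| * h.
      apply: le_trans (ler_norm _) _; rewrite normrM ler_wpM2l// ler_norml; lra.
    nra.
have split3 : (\int[P]_w (expR (x * s n * Z n w))%:E =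
    \int[P]_(w in Z n @^-1` B) (expR (x * s n * Z n w))%:E +
    (\int[P]_(w in Z n @^-1` U) (expR (x * s n * Z n w))%:E +
     \int[P]_(w in Z n @^-1` D) (expR (x * s n * Z n w))%:E))%E.
  have BUD : Z n @^-1` B `|` (Z n @^-1` U `|` Z n @^-1` D) = [set: T].
    apply/seteqP; split => // w _; rewrite /B /U /D /= !in_itv/= ?andbT.
    case: (ltP (x - h) (Z n w)) => ?; last by right; right.
    by case: (ltP (Z n w) (x + h)) => ?; [left|right; left].
  have mE A : measurable_fun A (EFin \o (fun w => expR (x * s n * Z n w))).
    by apply: measurable_funTS; apply: measurable_expR_scale.
  have E0 w : (0 <= (expR (x * s n * Z n w))%:E)%E by rewrite lee_fin expR_ge0.
  rewrite -ge0_integral_setU//; [|exact: measurable_preimageZ..|]; last first.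
    apply/disj_setPS => w []; rewrite /B /U /D /= !in_itv/= ?andbT => ? ?; lra.
  rewrite -ge0_integral_setU//; [|exact: measurable_preimageZ
    |apply: measurableU; exact: measurable_preimageZ|]; last first.
    apply/disj_setPS => w []; rewrite /B /U /D /= !in_itv/= ?andbT.
    by move=> /andP[? ?] [?|?]; lra.
  by rewrite BUD.
move: lo; rewrite split3 => lo.
have PBfin : P (Z n @^-1` B) \is a fin_num.
  by apply: fin_num_measure; exact: measurable_preimageZ.
move: (le_trans lo (leeD hB (leeD hU hD))).
rewrite -(fineK PBfin) -EFinM -!EFinD !lee_fin.
set p := fine _; set c := h ^+ 2 / 8 => main.
have e1 : expR (s n * ((x + h) ^+ 2 / 2 + c - h * (x + h))) =
    expR (s n * (x ^+ 2 / 2 - c)) * expR (- (s n * (2 * c))).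
  by rewrite -expRD; congr expR; rewrite /c; field.
have e2 : expR (s n * ((x - h) ^+ 2 / 2 + c - (- h) * (x - h))) =
    expR (s n * (x ^+ 2 / 2 - c)) * expR (- (s n * (2 * c))).
  by rewrite -expRD; congr expR; rewrite /c; field.
(* the bound [16 / h ^+ 2 <= s n] was chosen for [4 <= s n * (2 * c)] *)
have small : expR (- (s n * (2 * c))) <= 1 / 4.
  have sc : 4 <= s n * (2 * c).
    rewrite (_ : 4 = 16 / h ^+ 2 * (2 * c)); last first.
      by rewrite /c; field; rewrite gt_eqF.
    by apply: ler_wpM2r => //; rewrite mulr_ge0 ?ltW.
  rewrite expRN div1r lef_pV2 ?posrE ?expR_gt0//.
  by apply: le_trans (expR_ge1Dx _); lra.
move: main; rewrite e1 e2 => main.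
have e3 : expR (- s n * (x ^+ 2 / 2 + c + `|x| * h)) =
    expR (s n * (x ^+ 2 / 2 - c)) / expR (s n * (x ^+ 2 + `|x| * h)).
  by rewrite -expRB; congr expR; field.
rewrite e3 mulrAC ler_pdivrMr ?expR_gt0//.
have := expR_gt0 (s n * (x ^+ 2 / 2 - c)).
nra.
Unshelve. all: by end_near. Qed.

Lemma scaled_lne_le (n : nat) (c y : R) (p : \bar R) :
  0 < s n -> 0 < c -> (0 <= p)%E ->
  (p <= (c * expR (s n * y))%:E)%E ->
  ((s n)^-1%:E * lne p <= (ln c / s n + y)%:E)%E.
Proof.
move=> sn0 c0 p0 py.
have cy0 : 0 < c * expR (s n * y) by rewrite mulr_gt0 ?expR_gt0.
have : (lne p <= (ln c + s n * y)%:E)%E.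
  rewrite (_ : (ln c + _)%:E = lne (c * expR (s n * y))%:E); last first.
    by rewrite lne_EFin// lnM ?posrE ?expR_gt0// expRK.
  by rewrite lee_lne// in_itv/= ?leey ?andbT// lee_fin ltW.
rewrite -[in X in X -> _](@lee_pmul2l _ (s n)^-1%:E) ?lte_fin ?invr_gt0//.
move=> /le_trans; apply; rewrite -EFinM lee_fin mulrDr mulKf ?gt_eqF//.
by rewrite mulrC.
Qed.

Lemma scaled_lne_ge (n : nat) (c y : R) (p : \bar R) :
  0 < s n -> 0 < c -> (p <= 1)%E ->
  ((c * expR (s n * y))%:E <= p)%E ->
  ((ln c / s n + y)%:E <= (s n)^-1%:E * lne p)%E.
Proof.
move=> sn0 c0 p1 py.
have cy0 : 0 < c * expR (s n * y) by rewrite mulr_gt0 ?expR_gt0.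
have : ((ln c + s n * y)%:E <= lne p)%E.
  rewrite (_ : (ln c + _)%:E = lne (c * expR (s n * y))%:E); last first.
    by rewrite lne_EFin// lnM ?posrE ?expR_gt0// expRK.
  rewrite lee_lne// in_itv/= ?leey ?andbT ?lee_fin ?(ltW cy0)//.
  by apply: (le_trans _ py); rewrite lee_fin ltW.
rewrite -[in X in X -> _](@lee_pmul2l _ (s n)^-1%:E) ?lte_fin ?invr_gt0//.
apply: le_trans; rewrite -EFinM lee_fin mulrDr mulKf ?gt_eqF//.
by rewrite mulrC.
Qed.

(** Every real [c] at most the infimum over the closure of [B] is a bound: all
    points of [B] satisfy [|x| >= sqrt (2 c)].  Arguing with such [c] treats
    finite and infinite infima, in particular the empty [B], alike. *)
Lemma ldp_upper_bound (B : set R) : measurable B ->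
  (limn_esup (fun n => (s n)^-1%:E * lne (P (Z n @^-1` B)))
   <= - ereal_inf [set (x ^+ 2 / 2)%:E | x in closure B])%E.
Proof.
move=> mB; rewrite leeNr.
set v := limn_esup _; set m := ereal_inf _.
suff bd (c : R) : (c%:E <= m -> v <= (- c)%:E)%E.
  have bd' (c : R) : (c%:E <= m -> c%:E <= - v)%E by move=> /bd; rewrite leeNr.
  case: (m) bd' => [c|bd'|_]; [exact| |by rewrite leNye].
  by rewrite leye_eq; apply/eqP/eqyP => c c0; exact: bd' (leey _).
move=> cm.
have [c0|c0] := leP c 0.
  apply: limn_esup_le_near; near=> n.
  have sn0 : 0 < s n by near: n.
  apply: (@le_trans _ _ 0%E); last by rewrite lee_fin oppr_ge0.
  rewrite mule_ge0_le0 ?lee_fin ?invr_ge0 ?(ltW sn0)// lne_le0.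
  by apply: probability_le1; exact: measurable_preimageZ.
pose r := Num.sqrt (2 * c).
have r2 : r ^+ 2 = 2 * c by rewrite sqr_sqrtr//; lra.
have Br x : B x -> r <= `|x|.
  move=> Bx; rewrite -[X in _ <= X]sqrtr_sqr ler_wsqrtr//.
  have : (c%:E <= (x ^+ 2 / 2)%:E)%E.
    apply: le_trans cm _; apply: ereal_inf_lbound.
    by exists x => //; exact: subset_closure.
  rewrite lee_fin; lra.
apply/lee_addgt0Pr => e e0.
apply: limn_esup_le_near; near=> n.
have sn0 : 0 < s n by near: n.
have sn1 : 2 * ln 2 / e <= s n by near: n; move/cvgryPge : s_infty; exact.
have PB : (P (Z n @^-1` B) <= (2 * expR (s n * (e / 2 - r ^+ 2 / 2)))%:E)%E.
  by near: n; apply: prob_tail_le => //; [lra|exact: sqrtr_ge0].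
apply: (le_trans (scaled_lne_le sn0 _ _ PB)) => //.
rewrite -EFinD lee_fin r2.
have : ln 2 / s n <= e / 2.
  by move: sn1; rewrite !ler_pdivrMr//; lra.
lra.
Unshelve. all: by end_near. Qed.

(** Each interior point [x] of [B] contributes [- x^2/2], through balls around
    [x] inside [B] of radius tending to 0. *)
Lemma ldp_lower_bound (B : set R) : measurable B ->
  (- ereal_inf [set (x ^+ 2 / 2)%:E | x in B°]
   <= limn_einf (fun n => (s n)^-1%:E * lne (P (Z n @^-1` B))))%E.
Proof.
move=> mB; rewrite leeNl; apply: le_ereal_inf_tmp => _ [x Bx <-].
rewrite leeNl; apply/lee_subgt0Pr => e e0.
have /nbhs_ballP[h0 /= h0_gt0 hB] := Bx.
(* as [h <= 1], the loss [h^2/8 + |x| h] is at most [h (1 + |x|) <= e/2] *)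
pose h := Num.min h0 (Num.min 1 (e / (2 * (1 + `|x|)))).
have x1 : 0 < 2 * (1 + `|x|) by rewrite mulr_gt0// ltr_pwDl.
have h_gt0 : 0 < h by rewrite !lt_min h0_gt0 ltr01 divr_gt0.
have hle0 : h <= h0 by rewrite ge_min lexx.
have hle1 : h <= 1 by rewrite !ge_min lexx orbT.
have hlee : h * (2 * (1 + `|x|)) <= e.
  by rewrite -ler_pdivlMr// !ge_min lexx !orbT.
apply: limn_einf_ge_near; near=> n.
have sn0 : 0 < s n by near: n.
have sn1 : 2 * ln 2 / e <= s n by near: n; move/cvgryPge : s_infty; exact.
set G := `]x - h, x + h[%classic.
have PG : ((expR (- s n * (x ^+ 2 / 2 + h ^+ 2 / 8 + `|x| * h)) / 2)%:E
    <= P (Z n @^-1` G))%E.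
  by near: n; exact: prob_ball_ge.
have PGB : (P (Z n @^-1` G) <= P (Z n @^-1` B))%E.
  apply: le_measure; rewrite ?inE.
  - by apply: measurable_preimageZ; exact: measurable_itv.
  - exact: measurable_preimageZ.
  - move=> w; rewrite /G /= in_itv/= => /andP[w1 w2]; apply: hB.
    by rewrite /ball/= ltr_norml; lra.
have PB := le_trans PG PGB.
have PB1 : (P (Z n @^-1` B) <= 1)%E.
  by apply: probability_le1; exact: measurable_preimageZ.
move: PB; rewrite mulNr -mulrN mulrC => PB.
apply: (le_trans _ (scaled_lne_ge sn0 _ PB1 PB)); last by rewrite invr_gt0.
rewrite -EFinB lee_fin lnV ?posrE// mulNr.
have : ln 2 / s n <= e / 2.
  by move: sn1; rewrite !ler_pdivrMr//; lra.
nra.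
Unshelve. all: by end_near. Qed.

End gartner_ellis.

Lemma half_square_good_rate (R : realType) :
  good_rate_function (fun x : R => (x ^+ 2 / 2)%:E).
Proof.
have cf : continuous (fun x : R => x ^+ 2 / 2).
  move=> x; apply: cvgM; last exact: cvg_cst.
  exact: exprn_continuous.
split.
- by move=> x; rewrite lee_fin divr_ge0 ?sqr_ge0.
- move=> x a; rewrite lte_fin => ax.
  exists [set y | a < y ^+ 2 / 2]; last by move=> y /=; rewrite lte_fin.
  exact: (cvgr_gt (x ^+ 2 / 2) (cf x)).
- move=> c; pose K := Num.sqrt (2 * `|c|).
  apply: (@subclosed_compact _ _ `[- K, K]); last 2 first.
  + exact: segment_compact.
  + move=> x /=; rewrite lee_fin in_itv/= -ler_norml -[`|x|]sqrtr_sqr => xc.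
    by rewrite ler_wsqrtr//; have := ler_norm c; lra.
  rewrite (_ : [set _ | _] = (fun x : R => x ^+ 2 / 2) @^-1` [set y | y <= c]).
    by apply: closed_comp => [x _|]; [exact: cf|exact: closed_le].
  by apply/seteqP; split => x /=; rewrite lee_fin.
Qed.

Lemma gartner_ellis_gaussian (R : realType) (d : measure_display)
    (T : measurableType d) (P : probability T R) (Z : nat -> T -> R)
    (s : nat -> R) :
  (forall n, measurable_fun setT (Z n)) ->
  s @ \oo --> +oo -> gaussian_log_mgf P Z s ->
  satisfies_ldp P Z s (fun x => (x ^+ 2 / 2)%:E).
Proof.
move=> mZ soo mgf; split; first exact: half_square_good_rate.
move=> B mB; split; last 2 first.
- exact: limn_einf_sup.
- exact: ldp_upper_bound.
- exact: ldp_lower_bound.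
Qed.

(** * The eigenfunctions of the Engel chain *)

Section eigenfunction.
Context (R : realType).
Implicit Types (t : R) (m : nat).

(** The eigenfunction for the eigenvalue [(1 - t)^-1], in the variable
    [m = q - 2] that numbers the possible digits [q >= 2] from 0. *)
Definition engel_eigen t m : R := \prod_(i < m) (1 + t / i.+1%:R).

Lemma engel_eigenS t m : engel_eigen t m.+1 = engel_eigen t m * (1 + t / m.+1%:R).
Proof. by rewrite /engel_eigen big_ord_recr. Qed.

Let factor_gt0 t m : `|t| <= 2^-1 -> 0 < 1 + t / m.+1%:R.
Proof.
rewrite ler_norml => /andP[t1 t2].
have m1 : 1 <= m.+1%:R :> R by rewrite ler1n.
by rewrite -ltrBlDl sub0r ltr_pdivlMr ?ltr0n//; lra.
Qed.

Lemma engel_eigen_gt0 t m : `|t| <= 2^-1 -> 0 < engel_eigen t m.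
Proof. by move=> ht; apply: prodr_gt0 => i _; exact: factor_gt0. Qed.

Lemma ln1D_ge (x : R) : -1 < x -> x / (1 + x) <= ln (1 + x).
Proof.
move=> x1; have x0 : 0 < 1 + x by lra.
have := @le_ln1Dx R (- x / (1 + x)).
have -> : 1 + - x / (1 + x) = (1 + x)^-1 by field; lra.
rewrite lnV ?posrE// => H.
have : -1 < - x / (1 + x) by rewrite ltr_pdivlMr//; lra.
move=> /H; rewrite mulNr; lra.
Qed.

(** Both logarithms lie between [z / (1 + z)] and [z], for [z = t y] and
    [z = y].  The error is written with [y - y / (1 + y)] because this
    telescopes at [y = 1 / (m + 1)]. *)
Lemma ln_factor_le t (y : R) : `|t| <= 2^-1 -> 0 < y <= 1 ->
  `|ln (1 + t * y) - t * ln (1 + y)| <= 3 * `|t| * (y - y / (1 + y)).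
Proof.
rewrite ler_norml => /andP[t1 t2] /andP[y0 y1].
have ty : -1 < t * y by nra.
have y2 : 0 < 1 + y by lra.
have ty2 : 0 < 1 + t * y by lra.
have A1 := le_ln1Dx ty; have A2 := ln1D_ge ty.
have B1 : ln (1 + y) <= y by apply: le_ln1Dx; lra.
have B2 : y / (1 + y) <= ln (1 + y) by apply: ln1D_ge; lra.
have q1 : y / (1 + y) <= y by rewrite ler_pdivrMr//; nra.
set q := y / (1 + y) in B2 q1 *.
rewrite ler_norml.
have [t0|t0] := leP 0 t; [rewrite ger0_norm//|rewrite ltr0_norm//].
  have : t * q <= t * y / (1 + t * y).
    rewrite /q mulrA ler_wpM2l ?mulr_ge0 ?(ltW y0)//.
    by rewrite lef_pV2 ?posrE//; nra.
  by move=> ?; apply/andP; split; nra.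
have : y / (1 + t * y) <= 3 * y - 2 * q.
  have -> : 3 * y - 2 * q = y * ((1 + 3 * y) / (1 + y)) by rewrite /q; field; lra.
  rewrite ler_wpM2l ?(ltW y0)// -[X in X <= _]mul1r ler_pdivrMr// mulrAC.
  by rewrite ler_pdivlMr//; nra.
rewrite -mulrA in A2.
by move=> ?; apply/andP; split; nra.
Qed.

Lemma ln_engel_eigen t m : `|t| <= 2^-1 ->
  `|ln (engel_eigen t m) - t * ln m.+1%:R| <= 3 * `|t| * (1 - m.+1%:R^-1).
Proof.
move=> ht; elim: m => [|m IH].
  by rewrite /engel_eigen big_ord0 ln1 mulr0 subrr normr0 invr1 subrr mulr0.
have m0 : 0 < m.+1%:R :> R by rewrite ltr0n.
have m1 : 1 <= m.+1%:R :> R by rewrite ler1n.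
pose y : R := m.+1%:R^-1.
have y1 : 0 < y <= 1 by rewrite invr_gt0 m0 invf_le1.
have y2 : 1 + y = m.+2%:R / m.+1%:R by rewrite /y -[m.+2%:R]natr1; field; lra.
have lny : ln (1 + y) = ln m.+2%:R - ln m.+1%:R.
  by rewrite y2 ln_div ?posrE ?ltr0n.
have yy : y / (1 + y) = m.+2%:R^-1.
  by rewrite y2 /y -[m.+2%:R]natr1; field; lra.
have := ln_factor_le ht y1.
rewrite engel_eigenS lnM ?posrE ?engel_eigen_gt0 ?factor_gt0// lny yy -/y.
move: IH; rewrite -/y !ler_norml => /andP[i1 i2] /andP[j1 j2].
move: (ln _) (ln _) (ln _) (ln _) (m.+2%:R^-1) i1 i2 j1 j2 => A B C D E i1 i2 j1 j2.
by clear -i1 i2 j1 j2; apply/andP; split; lra.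
Qed.

(** Replacing [ln (q - 1)] by [ln q] costs at most one more [|t|]. *)
Lemma ln_engel_eigen_digit t q : `|t| <= 2^-1 -> (2 <= q)%N ->
  `|ln (engel_eigen t (q - 2)) - t * ln q%:R| <= 4 * `|t|.
Proof.
move=> ht; case: q => [//|[//|m]] _; rewrite subn2/=.
have := ln_engel_eigen m ht.
have m0 : 0 < m.+1%:R :> R by rewrite ltr0n.
have m1 : 1 <= m.+1%:R :> R by rewrite ler1n.
have y0 : 0 < m.+1%:R^-1 :> R by rewrite invr_gt0.
have d : `|t * ln m.+2%:R - t * ln m.+1%:R| <= `|t|.
  rewrite -mulrBr normrM ler_piMr// -ln_div ?posrE ?ltr0n//.
  have -> : m.+2%:R / m.+1%:R = 1 + m.+1%:R^-1 :> R.
    by rewrite -[m.+2%:R]natr1; field; lra.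
  have le1 : m.+1%:R^-1 <= 1 :> R by rewrite invf_le1.
  move: y0 le1; set y := _^-1 => y0 y1.
  rewrite ger0_norm ?ln_ge0//; last lra.
  by apply: (le_trans (le_ln1Dx _)); lra.
move: d; rewrite !ler_norml => /andP[d1 d2] /andP[e1 e2].
have ty : 0 <= `|t| * m.+1%:R^-1 by rewrite mulr_ge0// ltW.
rewrite mulrBr mulr1 -(mulrA 3 `|t| _^-1) in e1 e2.
move: (ln _) (ln _) (ln _) (_ * _^-1) ty d1 d2 e1 e2 => A B C D ty d1 d2 e1 e2.
by clear -ty d1 d2 e1 e2; apply/andP; split; lra.
Qed.

(** [f_t(q) / (q - 1)] for [q = m + 2]: its differences are, up to the factor
    [1 - t], the summands of the eigenvalue equation. *)
Definition engel_potential t m : R := engel_eigen t m / m.+1%:R.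

Lemma engel_potential_diff t m :
  engel_potential t m - engel_potential t m.+1 =
  (1 - t) * (engel_eigen t m / (m.+1%:R * m.+2%:R)).
Proof.
rewrite /engel_potential engel_eigenS.
have m0 : 0 < m.+1%:R :> R by rewrite ltr0n.
by rewrite -[m.+2%:R]natr1; field; lra.
Qed.

(** The bound on [ln f_t] gives [f_t(m + 2)^2 <= e^3 (m + 1)]. *)
Lemma engel_potential_cvg0 t : `|t| <= 2^-1 -> engel_potential t @ \oo --> 0.
Proof.
move=> ht; apply/cvgr0Pnorm_lt => e e0; near=> m.
have m0 : 0 < m.+1%:R :> R by rewrite ltr0n.
have e2 : 0 < e ^+ 2 by rewrite exprn_gt0.
have g0 : 0 < engel_potential t m by rewrite divr_gt0// engel_eigen_gt0.
rewrite gtr0_norm// -(@ltr_pXn2r _ 2) ?nnegrE ?(ltW g0) ?(ltW e0)//.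
have E2 : engel_eigen t m ^+ 2 <= expR 3 * m.+1%:R.
  have E0 := engel_eigen_gt0 m ht.
  rewrite -[X in X ^+ 2]lnK ?posrE// -[m.+1%:R in X in _ <= X]lnK ?posrE//.
  rewrite -expRM_natl -expRD ler_expR.
  have := ln_engel_eigen m ht; rewrite ler_norml => /andP[_].
  have : 0 <= ln m.+1%:R :> R by rewrite ln_ge0// ler1n.
  have : 0 <= m.+1%:R^-1 :> R by rewrite invr_ge0.
  have := le_trans (ler_norm t) ht; have := normr_ge0 t.
  move: (ln _) (ln _) (m.+1%:R^-1) `|t| ht => A L y u u2 u0 t2 y0 L0 H.
  have tL : t * L <= 2^-1 * L by rewrite ler_wpM2r.
  have uy : 0 <= u * y by rewrite mulr_ge0.
  by rewrite mulrBr mulr1 -mulrA in H; clear -u2 tL uy H; lra.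
have mb : expR 3 / e ^+ 2 < m.+1%:R.
  rewrite -[m.+1%:R]natr1; apply: (@le_lt_trans _ _ m%:R); last by rewrite ltrDl.
  by near: m; exact: nbhs_infty_ger.
apply: (@le_lt_trans _ _ (expR 3 / m.+1%:R)).
  rewrite /engel_potential expr_div_n ler_pdivrMr ?exprn_gt0//.
  by rewrite mulrAC expr2 mulrA mulfK ?gt_eqF.
by rewrite ltr_pdivrMr// mulrC -ltr_pdivrMr.
Unshelve. all: by end_near. Qed.

(** The eigenvalue equation, divided by [m + 1]: the series telescopes. *)
Lemma engel_eigen_sum t m : `|t| <= 2^-1 ->
  (\sum_(i <oo) (engel_eigen t (m + i) / ((m + i).+1%:R * (m + i).+2%:R))%:E =
   ((1 - t)^-1 * engel_potential t m)%:E)%E.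
Proof.
move=> ht; have t1 : 0 < 1 - t by move: ht; rewrite ler_norml => /andP[]; lra.
apply: cvg_lim => //.
have psum n : (\sum_(0 <= i < n)
    (engel_eigen t (m + i) / ((m + i).+1%:R * (m + i).+2%:R))%:E)%E
   = ((1 - t)^-1 * (engel_potential t m - engel_potential t (m + n)))%:E.
  elim: n => [|n IH]; first by rewrite big_geq// addn0 subrr mulr0.
  rewrite big_nat_recr//= IH -EFinD addnS; congr _%:E.
  rewrite -[X in _ + X](mulKf (lt0r_neq0 t1)) -engel_potential_diff -mulrDr.
  by congr (_ * _); rewrite addrA subrK.
rewrite (_ : (fun n => _) = (fun n => ((1 - t)^-1 *
  (engel_potential t m - engel_potential t (m + n)))%:E)); last exact/funext.
apply: cvg_EFin; first exact: nearW.
have -> : engel_potential t m = engel_potential t m - 0 by rewrite subr0.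
apply: cvgM; first exact: cvg_cst.
apply: cvgB; first by rewrite subr0; exact: cvg_cst.
rewrite (_ : (fun n => _) = [sequence engel_potential t (n + m)]_n); last first.
  by apply/funext => n; rewrite addnC.
by rewrite (cvg_shiftn m (engel_potential t)); exact: engel_potential_cvg0.
Qed.
End eigenfunction.

(** * Affine change of variable for the Lebesgue integral *)

Section affine_change_of_variable.
Context (R : realType).
Local Notation mu := (@lebesgue_measure R).

Let affine (c b x : R) := c * x + b.

Let measurable_affine c b :
  measurable_fun setT (affine c b : measurableTypeR R -> measurableTypeR R).
Proof.
have : measurable_fun setT (affine c b); last by [].
by apply: measurable_funD => //; exact: measurable_funM.
Qed.

Lemma preimage_affine_oc (c b u v : R) : 0 < c ->
  (fun x => c * x + b) @^-1` `]u, v] = `](u - b) / c, (v - b) / c]%classic.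
Proof.
move=> c0; apply/seteqP; split => x /=; rewrite !in_itv/=;
  by rewrite ltr_pdivrMr// ler_pdivlMr// ltrBlDr lerBrDr mulrC.
Qed.

(** Lebesgue measure is [c] times its image under [x |-> c x + b], because the
    two agree on half-open intervals. *)
Lemma ge0_integral_affine (c b : R) (D : set R) (f : R -> \bar R) : 0 < c ->
  measurable D -> measurable_fun D f -> (forall x, D x -> 0 <= f x)%E ->
  (\int[mu]_(x in (fun x => (c * x + b)%R) @^-1` D) f (c * x + b)%R =
   c^-1%:E * \int[mu]_(x in D) f x)%E.
Proof.
move=> c0 mD mf f0.
pose phi : measurableTypeR R -> measurableTypeR R := affine c b.
pose cnng : {nonneg R} := NngNum (ltW c0).
pose push := [the {measure set (measurableTypeR R) -> \bar R} of
  pushforward mu phi].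
pose nu := [the {measure set (measurableTypeR R) -> \bar R} of
  mscale cnng (push (measurable_affine c b))].
have nuE A : measurable A -> mu A = nu A.
  apply: lebesgue_measure_unique => _ [[u v] _ <-].
  transitivity (c%:E * mu `]((u - b) / c)%R, ((v - b) / c)%R])%E; last first.
    by apply/esym; congr (_ * mu _)%E; exact: preimage_affine_oc.
  rewrite !lebesgue_measure_itv/= !lte_fin.
  rewrite ltr_pM2r ?invr_gt0// ltrD2r; case: ifPn => _; last by rewrite mule0.
  rewrite -!EFinB -EFinM; congr _%:E; field; lra.
rewrite (@eq_measure_integral _ (measurableTypeR R) _ D nu); last first.
  by move=> A mA _; exact: nuE.
rewrite ge0_integral_mscale// muleA -EFinM mulVf ?gt_eqF// mul1e.
rewrite ge0_integral_pushforward//; first exact: measurable_affine.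
by move=> y /set_mem; exact: f0.
Qed.

End affine_change_of_variable.

(** * The Engel map and the measurability of the digits *)

Section engel_digits.
Context (R : realType).
Implicit Types (x : R).
Local Notation mu := (@lebesgue_measure R).

Definition engel_map x : R := (Num.truncn x^-1).+1%:R * x - 1.
Definition engel_orbit_digit n x : nat := (Num.truncn (iter n engel_map x)^-1).+1.

Lemma engel_digitE n x : 0 < x < 1 -> engel_digit x n = engel_orbit_digit n.-1 x.
Proof.
move=> x01; have [q xq] := engel_expansion_ex x01.
have -> : engel_digit x n = q n.-1.
  congr (_ n.-1); apply: (@engel_expansion_uniq _ x) => //.
  by apply: (xgetPex (fun=> 2%N)); exists q.
elim: n.-1 x q xq {x01} => [|k IH] x q xq; rewrite /engel_orbit_digit.
  by rewrite (engel_expansion_first xq).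
rewrite iterSr -/(engel_orbit_digit k _) -(IH _ (q \o succn))//.
rewrite /engel_map -(engel_expansion_first xq).
exact: engel_expansion_tail.
Qed.

(** The points of [(0, 1]] with first digit [l + 2]. *)
Definition engel_cyl l : set R := `](l.+2%:R)^-1, (l.+1%:R)^-1].

Lemma truncn_invE x l : (Num.truncn x^-1 = l.+1) <-> engel_cyl l x.
Proof.
rewrite /engel_cyl /= in_itv/=.
have [x0|x0] := ltP 0 x; last first.
  split=> [xl|].
    have : (0 < Num.truncn x^-1)%N by rewrite xl.
    rewrite truncn_gt0 => x1; have : x^-1 <= 0 by rewrite invr_le0.
    by rewrite leNgt (lt_le_trans _ x1).
  move=> /andP[h _]; have : 0 < x by apply: lt_trans h; rewrite invr_gt0.
  by rewrite ltNge x0.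
have xi0 : 0 < x^-1 by rewrite invr_gt0.
rewrite invf_plt ?posrE// -[X in _ && (X <= _)]invrK lef_pV2 ?posrE// andbC.
by rewrite -truncn_eq ?ltW//; split => /eqP.
Qed.

Lemma engel_cyl_bigcup m :
  (`]0, (m.+1%:R)^-1]%classic : set R) = \bigcup_i engel_cyl (m + i).
Proof.
apply/seteqP; split => [x /=|x [i _]]; rewrite /engel_cyl/= !in_itv/=.
  move=> /andP[x0 xm].
  have : m.+1%:R <= x^-1 by rewrite -[m.+1%:R]invrK lef_pV2 ?posrE// invr_gt0.
  rewrite -truncn_ge_nat ?invr_ge0 ?ltW// => mx.
  exists (Num.truncn x^-1 - m.+1)%N => //.
  by apply/truncn_invE; rewrite -addSn subnKC.
move=> /andP[lx ux]; rewrite (lt_trans _ lx) ?invr_gt0//=.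
by rewrite (le_trans ux)// lef_pV2 ?posrE ?ler_nat ?ltnS ?leq_addr.
Qed.

Lemma trivIset_engel_cyl m : trivIset setT (fun i => engel_cyl (m + i)).
Proof.
move=> i j _ _ [x [/truncn_invE xi /truncn_invE]].
by rewrite xi => -[] /addnI.
Qed.

Lemma measurable_nat_valued (f : R -> nat) :
  (forall k, measurable (f @^-1` [set k])) -> measurable_fun setT f.
Proof.
move=> mf _ Y _; rewrite setTI.
have -> : f @^-1` Y = \bigcup_(k in Y) f @^-1` [set k].
  by apply/seteqP; split => [x Yx|x [k Yk fx]]; [exists (f x)|rewrite /= fx].
exact: bigcup_measurable.
Qed.

Lemma measurable_truncn_inv :
  measurable_fun setT (fun x : R => Num.truncn x^-1).
Proof.
have mS l : measurable ((fun x : R => Num.truncn x^-1) @^-1` [set l.+1]).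
  rewrite (_ : _ @^-1` _ = engel_cyl l); first exact: measurable_itv.
  by apply/seteqP; split => x /=; rewrite truncn_invE.
apply: measurable_nat_valued => -[|l]; last exact: mS.
rewrite (_ : _ @^-1` _ =
  ~` \bigcup_l ((fun x : R => Num.truncn x^-1) @^-1` [set l.+1])).
  by apply: measurableC; exact: bigcupT_measurable.
apply/seteqP; split => x /= => [x0 [l _ /=]|]; first by rewrite x0.
by case E : (Num.truncn x^-1) => [//|l] []; exists l.
Qed.

Lemma measurable_engel_map : measurable_fun setT engel_map.
Proof.
apply: measurable_funB => //; apply: measurable_funM => //.
have -> : (fun x : R => (Num.truncn x^-1).+1%:R : R) =
  (fun k : nat => k.+1%:R) \o (fun x : R => Num.truncn x^-1) by [].
by apply: measurableT_comp; [|exact: measurable_truncn_inv].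
Qed.

Lemma measurable_engel_orbit_digit n : measurable_fun setT (engel_orbit_digit n).
Proof.
have -> : engel_orbit_digit n =
  succn \o (fun x : R => Num.truncn x^-1) \o iter n engel_map by [].
apply: measurableT_comp.
  by apply: measurableT_comp => //; exact: measurable_truncn_inv.
elim: n => [|n IH]; first exact: measurable_id.
by apply: measurableT_comp => //; exact: measurable_engel_map.
Qed.

(** Only points of [(0, 1]] have an expansion; elsewhere the digit is the
    default value. *)
Lemma engel_digit_out n x : ~ (0 < x <= 1) -> engel_digit x n = 2%N.
Proof.
move=> x01; rewrite /engel_digit; case: xgetP => // q _ xq; exfalso; apply: x01.
have [q2 _ _] := xq; have /andP[lx ux] := engel_expansion_bounds xq.
have a2 : 2 <= (q 0)%:R :> R by rewrite ler_nat.
rewrite (lt_trans _ lx) ?invr_gt0/=; last lra.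
by rewrite (le_trans ux)// invf_le1; lra.
Qed.

(** The point 1 needs no computation: one point does not affect
    measurability. *)
Lemma measurable_engel_digit n :
  measurable_fun setT (fun x : R => engel_digit x n).
Proof.
rewrite (_ : (fun x => _) = (fun x =>
    if 0 < x < 1 then engel_orbit_digit n.-1 x
    else if x == 1 then engel_digit (1 : R) n else 2%N)); last first.
  apply/funext => x; case: ifPn => [x01|x01]; first exact: engel_digitE.
  case: eqVneq => [->//|x1]; apply: engel_digit_out => /andP[x0 xle].
  by move: x01; rewrite x0 lt_neqAle x1 xle.
apply: measurable_fun_ifT.
- apply: measurable_and; exact: measurable_fun_ltr.
- exact: measurable_engel_orbit_digit.
- apply: measurable_fun_ifT => //; exact: measurable_fun_eqr.
Qed.

End engel_digits.

(** * Exact moments of the digits of a uniform number *)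

Section engel_moments.
Context (R : realType).
Local Notation mu := (@lebesgue_measure R).

Lemma measurable_engel_eigen t (D : R -> nat) : measurable_fun setT D ->
  measurable_fun setT (EFin \o (fun x : R => engel_eigen t (D x - 2) : R)).
Proof.
move=> mD; apply/measurable_EFinP.
by apply: (@measurableT_comp _ _ _ _ _ _ (fun k => engel_eigen t (k - 2))).
Qed.

(** The summation step: each cylinder contributes its length times [c f_t], so
    the eigenvalue equation evaluates the sum. *)
Lemma integral_engel_cyl_glue (t c : R) m (h : R -> \bar R) :
  `|t| <= 2^-1 -> 0 <= c ->
  measurable_fun setT h -> (forall x, 0 <= h x)%E ->
  (forall l, \int[mu]_(x in engel_cyl l) h x =
     (c * (engel_eigen t l / (l.+1%:R * l.+2%:R)))%:E)%E ->
  (\int[mu]_(x in `]0%R, (m.+1%:R)^-1%R]) h x =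
   (c * ((1 - t)^-1 * engel_potential t m))%:E)%E.
Proof.
move=> ht c0 mh h0 hl; rewrite engel_cyl_bigcup ge0_integral_bigcup//; last 3 first.
- by move=> k; exact: measurable_itv.
- exact: measurable_funTS.
- exact: trivIset_engel_cyl.
under eq_eseriesr do rewrite hl EFinM.
rewrite nneseriesZl; last first.
  by move=> i _; rewrite lee_fin divr_ge0// ltW// engel_eigen_gt0.
by rewrite engel_eigen_sum.
Qed.

Lemma engel_mapE l (x : R) : engel_cyl l x -> engel_map x = l.+2%:R * x - 1.
Proof. by move=> /truncn_invE xl; rewrite /engel_map xl. Qed.

Lemma lebesgue_engel_cyl l :
  mu (engel_cyl l) = ((l.+1%:R * l.+2%:R)^-1)%:E.
Proof.
rewrite /engel_cyl lebesgue_measure_itv/= lte_fin ltf_pV2 ?posrE// ltr_nat leqnn.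
rewrite -EFinB; congr _%:E.
have : l.+1%:R != 0 :> R by rewrite pnatr_eq0.
have : l.+2%:R != 0 :> R by rewrite pnatr_eq0.
by rewrite -[l.+2%:R]natr1 => ? ?; field; exact/andP.
Qed.

(** The digits of a uniform point of [(0, 1/(m+1)]] are distributed like those
    that follow a digit [m + 2], which is why [f_t(m + 2)] appears.  The
    induction runs through all [m] at once, because the Engel map carries the
    cylinder of the first digit [l + 2] onto [(0, 1/(l+1)]]. *)
Lemma integral_engel_eigen (t : R) n m : `|t| <= 2^-1 ->
  (\int[mu]_(x in `]0%R, (m.+1%:R)^-1%R])
     (engel_eigen t (engel_orbit_digit n x - 2))%:E
   = ((1 - t)^-1 ^+ n.+1 * engel_potential t m)%:E)%E.
Proof.
move=> ht; have t1 : 0 < 1 - t by move: ht; rewrite ler_norml => /andP[]; lra.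
have l0 : 0 < (1 - t)^-1 by rewrite invr_gt0.
have E0 k : (0 <= (engel_eigen t k)%:E)%E.
  by rewrite lee_fin ltW// engel_eigen_gt0.
elim: n m => [|n IH] m.
  rewrite (@integral_engel_cyl_glue t 1)//; first by rewrite mul1r expr1.
    exact: measurable_engel_eigen (measurable_engel_orbit_digit _).
  move=> l; rewrite mul1r.
  transitivity (\int[mu]_(x in engel_cyl l) (cst (engel_eigen t l)%:E) x)%E.
    apply: eq_integral => x /set_mem /truncn_invE xl.
    by rewrite /engel_orbit_digit /= xl subn2.
  rewrite integral_cst; last exact: measurable_itv.
  by rewrite EFinM; congr (_ * _)%E; exact: lebesgue_engel_cyl.
rewrite (@integral_engel_cyl_glue t ((1 - t)^-1 ^+ n.+1))//.
- by rewrite mulrA -exprSr.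
- by rewrite exprn_ge0// ltW.
- exact: measurable_engel_eigen (measurable_engel_orbit_digit _).
move=> l.
have cylE : (fun x : R => l.+2%:R * x + -1) @^-1` `]0, (l.+1%:R)^-1]%classic
    = engel_cyl l.
  have c0 : 0 < l.+2%:R :> R by [].
  rewrite (preimage_affine_oc (-1) 0 (l.+1%:R^-1) c0) opprK add0r div1r.
  suff -> : (l.+1%:R^-1 + 1) / l.+2%:R = l.+1%:R^-1 :> R by [].
  have : l.+1%:R != 0 :> R by rewrite pnatr_eq0.
  have : l.+2%:R != 0 :> R by rewrite pnatr_eq0.
  by rewrite -[l.+2%:R]natr1 => ? ?; field; exact/andP.
transitivity (\int[mu]_(x in engel_cyl l)
    (engel_eigen t (engel_orbit_digit n (l.+2%:R * x + -1) - 2))%:E)%E.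
  apply: eq_integral => x /set_mem xl.
  by rewrite /engel_orbit_digit iterSr (engel_mapE xl).
rewrite -cylE (@ge0_integral_affine _ _ _ _
  (fun y => (engel_eigen t (engel_orbit_digit n y - 2))%:E))//; last first.
  apply: measurable_funTS.
  exact: measurable_engel_eigen (measurable_engel_orbit_digit _).
rewrite IH -EFinM /engel_potential; congr _%:E.
have : l.+1%:R != 0 :> R by rewrite pnatr_eq0.
have : l.+2%:R != 0 :> R by rewrite pnatr_eq0.
move=> ? ?; rewrite invfM; ring.
Qed.

Lemma engel_moment (d : measure_display) (T : measurableType d)
    (P : probability T R) (X : {RV P >-> R}) (t : R) n :
  (forall A : set R, measurable A ->
     distribution P X A = uniform_prob (@ltr01 R) A) ->
  `|t| <= 2^-1 -> (0 < n)%N ->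
  (\int[P]_w (engel_eigen t (engel_digit (X w) n - 2))%:E =
   ((1 - t)^-1 ^+ n)%:E)%E.
Proof.
move=> hX ht n0.
pose f (x : R) := (engel_eigen t (engel_digit x n - 2))%:E.
have mf : measurable_fun setT f.
  exact: measurable_engel_eigen (measurable_engel_digit _).
have f0 x : (0 <= f x)%E by rewrite lee_fin ltW// engel_eigen_gt0.
(* [measurableTypeR R] carries the same sigma-algebra as [R] under another
   display, the one on which Lebesgue measure is defined *)
pose Y : T -> measurableTypeR R := X.
have mY : measurable_fun setT Y by exact: (measurable_funPT X).
transitivity (\int[pushforward P Y]_x f x)%E.
  by rewrite ge0_integral_pushforward.
rewrite (@eq_measure_integral _ (measurableTypeR R) _ setT
  (uniform_prob (@ltr01 R))); last first.
  by move=> A mA _; exact: hX.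
rewrite integral_uniform// subr0 invr1 mul1e.
rewrite -integral_itv_obnd_cbnd; last exact: measurable_funTS.
rewrite -integral_itv_bndo_bndc; last exact: measurable_funTS.
have := @integral_engel_eigen t n.-1 0 ht.
rewrite invr1 prednK// /engel_potential /engel_eigen big_ord0 divr1 mulr1 => <-.
rewrite -integral_itv_bndo_bndc; last first.
  apply: measurable_funTS.
  exact: measurable_engel_eigen (measurable_engel_orbit_digit _).
apply: eq_integral => x /set_mem /=; rewrite in_itv/= => x01.
by rewrite /f engel_digitE.
Qed.

End engel_moments.

(** * The Laplace transform of [log q_n - n] *)

(** The left-hand side has derivative [x^2 / (1 - x)] in [x], at most [2 x^2]
    for [|x| <= 1/2]; apply the mean value theorem between 0 and [t]. *)
Lemma ln1B_expansion (R : realType) (t : R) : `|t| <= 2^-1 ->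
  `|- ln (1 - t) - t - t ^+ 2 / 2| <= 2 * `|t| ^+ 3.
Proof.
move=> ht.
pose g (x : R) := - ln (1 - x) - x - x ^+ 2 / 2.
pose g' (x : R) := x ^+ 2 / (1 - x).
have dg (x : R) : x < 1 -> is_derive x 1 g (g' x).
  move=> x1; have x0 : 0 < 1 - x by lra.
  have dln : is_derive x 1 (fun y : R => ln (1 - y)) (- (1 - x)^-1).
    have h := is_derive1_ln x0.
    have d1 : is_derive x 1 (fun y : R => 1 - y) (- 1).
      by apply: is_derive_eq; rewrite add0r mul1r.
    have := @is_derive1_comp _ (@ln R) (fun y => 1 - y) x _ _ h d1.
    by rewrite mulrN1.
  apply: is_derive_eq.
  rewrite /g' /GRing.scale /=; field; lra.
have small (a b : R) : - 2^-1 <= a -> b <= 2^-1 -> a <= b ->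
    exists2 c, c \in `[a, b] & g b - g a = g' c * (b - a).
  move=> a2 b2 ab; apply: MVT_segment => //.
    move=> x; rewrite in_itv/= => /andP[_ xb]; apply: dg; lra.
  apply: derivable_within_continuous => x; rewrite in_itv/= => /andP[_ xb].
  have xl : x < 1 by lra.
  by have [] := dg _ xl.
have g0 : g 0 = 0 by rewrite /g !subr0 ln1; lra.
have bd c : `|c| <= `|t| -> `|g' c| <= 2 * `|t| ^+ 2.
  move=> ct; have : `|c| <= 2^-1 by apply: le_trans ht.
  rewrite ler_norml => /andP[c1 c2].
  rewrite /g' ger0_norm; last by rewrite divr_ge0 ?sqr_ge0; lra.
  rewrite ler_pdivrMr; last lra.
  have : c ^+ 2 <= `|t| ^+ 2.
    by rewrite -(real_normK (num_real c)) lerXn2r ?nnegrE.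
  have : 0 <= `|t| ^+ 2 by rewrite sqr_ge0.
  nra.
have [t1 t2] : - 2^-1 <= t /\ t <= 2^-1.
  by move: ht; rewrite ler_norml => /andP[].
suff [c ct gt] : exists2 c, `|c| <= `|t| & g t = g' c * t.
  rewrite -/(g t) gt normrM exprSr mulrA ler_wpM2r//; exact: bd.
have [t0|t0] := leP 0 t.
  have [|//|//|c] := small 0 t; first lra.
  rewrite in_itv/= g0 !subr0 => /andP[c0 ct] ->; exists c => //.
  by rewrite !ger0_norm// (le_trans c0).
have [//||//|c] := small t 0; [lra|lra|].
rewrite in_itv/= g0 sub0r => /andP[tc c0] h; exists c; last by lra.
by rewrite ler0_norm// ltr0_norm// lerN2.
Qed.

Section engel_moderate_deviations.
Context (R : realType) (d : measure_display) (T : measurableType d).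
Context (P : probability T R) (X : {RV P >-> R}).
Context (X_unif : forall A : set R, measurable A ->
  distribution P X A = uniform_prob (@ltr01 R) A).

Lemma engel_digit_ge2 (x : R) n : (2 <= engel_digit x n)%N.
Proof.
rewrite /engel_digit; case: xgetP => [q _ [q2 _ _]|_]; [exact: q2|by []].
Qed.

Lemma measurable_engel_digit_RV n :
  measurable_fun setT (fun w => engel_digit (X w) n).
Proof.
apply: (@measurableT_comp _ _ _ _ _ _ (fun x : R => engel_digit x n) setT X) => //.
exact: measurable_engel_digit.
Qed.

Lemma measurable_ln_engel_digit n :
  measurable_fun setT (fun w => ln (engel_digit (X w) n)%:R : R).
Proof.
apply: (@measurableT_comp _ _ _ _ _ _ (fun k : nat => ln (k%:R : R)) setT) => //.
exact: measurable_engel_digit_RV.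
Qed.

(** Replace [q_n^t] by [f_t(q_n)], whose mean is [exp (- n ln (1 - t))], at the
    price of a factor [e^2] in either direction. *)
Lemma engel_log_mgf (t : R) n : `|t| <= 2^-1 -> (0 < n)%N ->
  ((expR (n%:R * (t ^+ 2 / 2 - 2 * `|t| ^+ 3) - 2))%:E
   <= \int[P]_w (expR (t * (ln (engel_digit (X w) n)%:R - n%:R)))%:E
   <= (expR (n%:R * (t ^+ 2 / 2 + 2 * `|t| ^+ 3) + 2))%:E)%E.
Proof.
move=> ht n0.
have t1 : 0 < 1 - t by move: ht; rewrite ler_norml => /andP[]; lra.
pose E w := engel_eigen t (engel_digit (X w) n - 2).
have mE : measurable_fun setT (EFin \o E).
  apply/measurable_EFinP.
  apply: (@measurableT_comp _ _ _ _ _ _ (fun k => engel_eigen t (k - 2)) setT)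
    => //.
  exact: measurable_engel_digit_RV.
have mL : measurable_fun setT
    (EFin \o (fun w => expR (t * (ln (engel_digit (X w) n)%:R - n%:R)))).
  apply/measurable_EFinP; apply: measurableT_comp; first exact: measurable_expR.
  apply: measurable_funM => //; apply: measurable_funB => //.
  exact: measurable_ln_engel_digit.
have E0 w : 0 < E w by exact: engel_eigen_gt0.
have EL w : `|ln (E w) - t * ln (engel_digit (X w) n)%:R| <= 2.
  apply: le_trans (ln_engel_eigen_digit ht (engel_digit_ge2 _ _)) _; lra.
have intE c : (\int[P]_w ((expR c)%:E * (E w)%:E) =
    (expR (c - n%:R * ln (1 - t)))%:E)%E.
  rewrite ge0_integralZl//; last by move=> w _; rewrite lee_fin ltW.
  rewrite (engel_moment X_unif ht n0) -EFinM expRD; congr (_ * _)%:E.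
  by rewrite -mulrN expRM_natl expRN lnK.
have := ln1B_expansion ht; rewrite ler_norml => /andP[x1 x2].
have n1 : 0 <= n%:R :> R by [].
apply/andP; split.
- apply: (@le_trans _ _
    (\int[P]_w ((expR (- (n%:R * t) - 2))%:E * (E w)%:E))%E).
    rewrite intE lee_fin ler_expR; nra.
  apply: ge0_le_integral => //.
  + by move=> w _; rewrite -EFinM lee_fin mulr_ge0 ?expR_ge0 ?ltW.
  + exact: emeasurable_funM.
  + move=> w _; rewrite -EFinM lee_fin -[E w]lnK ?posrE// -expRD ler_expR.
    by have := EL w; rewrite ler_norml => /andP[]; lra.
- apply: (@le_trans _ _
    (\int[P]_w ((expR (- (n%:R * t) + 2))%:E * (E w)%:E))%E); last first.
    rewrite intE lee_fin ler_expR; nra.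
  apply: ge0_le_integral => //.
  + exact: emeasurable_funM.
  + move=> w _; rewrite -EFinM lee_fin -[E w]lnK ?posrE// -expRD ler_expR.
    by have := EL w; rewrite ler_norml => /andP[]; lra.
Qed.

End engel_moderate_deviations.

(** * The moderate deviation principle *)

Theorem corollary2p3 (R : realType) (d : measure_display)
    (T : measurableType d) (P : probability T R) (X : {RV P >-> R})
    (hX : forall A : set R, measurable A ->
       distribution P X A = uniform_prob (@ltr01 R) A)
    (a : nat -> R)
    (ha_pos : forall n, (0 < n)%N -> 0 < a n)
    (ha_infty : a @ \oo --> +oo)
    (ha_small : (fun n => a n / Num.sqrt n%:R) @ \oo --> (0 : R)) :
  satisfies_ldp P
    (fun n w => (ln (engel_digit (X w) n)%:R - n%:R) / (a n * Num.sqrt n%:R))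
    (fun n => a n ^+ 2)
    (fun x => (x ^+ 2 / 2)%:E).
Proof.
have a_large (M : R) : \forall n \near \oo, M <= a n.
  by move/cvgryPge : ha_infty => /(_ M).
have a_small (c : R) : 0 < c ->
    \forall n \near \oo, `|a n / Num.sqrt n%:R| < c.
  by move=> c0; move/cvgr0Pnorm_lt : ha_small => /(_ c c0).
apply: gartner_ellis_gaussian.
- move=> n; apply: measurable_funM => //; apply: measurable_funB => //.
  exact: measurable_ln_engel_digit.
- apply/cvgryPge => A; near=> n.
  have aA : Num.max 1 A <= a n.
    by near: n; exact: a_large.
  move: aA; rewrite ge_max => /andP[a1 aA]; nra.
move=> t e e0.
have t2 : 0 < 4 * (t ^+ 2 + 1) * (`|t| + 1).
  by rewrite !mulr_gt0// ltr_wpDl ?sqr_ge0.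
have c0 : 0 < Num.min e 1 / (4 * (t ^+ 2 + 1) * (`|t| + 1)).
  by rewrite divr_gt0// lt_min e0 ltr01.
near=> n.
have n0 : (0 < n)%N by near: n; exact: nbhs_infty_gt.
have an0 := ha_pos n n0.
have an2 : 0 < a n ^+ 2 by rewrite exprn_gt0.
have sn0 : 0 < Num.sqrt n%:R :> R by rewrite sqrtr_gt0 ltr0n.
have aA : Num.max 1 (4 / e) <= a n.
  by near: n; exact: a_large.
(* one bound on [a n / sqrt n] that puts [th] below in the range [|th| <= 1/2]
   and makes the cubic error term at most [a_n^2 e/2] *)
have : `|a n / Num.sqrt n%:R| < Num.min e 1 / (4 * (t ^+ 2 + 1) * (`|t| + 1)).
  by near: n; exact: (a_small _ c0).
have r0 : 0 < a n / Num.sqrt n%:R by rewrite divr_gt0.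
rewrite (gtr0_norm r0); set r := a n / _ in r0 * => rs.
pose th := t * r.
have [th1 th2] : `|th| <= 2^-1 /\ 2 * t ^+ 2 * `|th| <= e / 2.
  move: rs; rewrite ltr_pdivlMr// lt_min => /andP[re r1].
  rewrite /th normrM (gtr0_norm r0).
  have u0 := normr_ge0 t; have v0 := sqr_ge0 t.
  have uv : 0 <= r * `|t| * t ^+ 2 by do 2?apply: mulr_ge0 => //; exact: ltW.
  have ru : 0 <= r * `|t| by apply: mulr_ge0 => //; exact: ltW.
  have rv : 0 <= r * t ^+ 2 by apply: mulr_ge0 => //; exact: ltW.
  move: (`|t|) (t ^+ 2) u0 v0 uv ru rv re r1 => u v u0 v0 uv ru rv re r1.
  by split; nra.
have nth : n%:R * th ^+ 2 = a n ^+ 2 * t ^+ 2.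
  rewrite /th /r -[n%:R in X in X * _]sqr_sqrtr//; field; lra.
have ae : 2 <= a n ^+ 2 * (e / 2).
  move: aA; rewrite ge_max ler_pdivrMr// => /andP[a1 ae]; nra.
have -> : (\int[P]_w (expR (t * a n ^+ 2 *
      ((ln (engel_digit (X w) n)%:R - n%:R) / (a n * Num.sqrt n%:R))))%:E
  = \int[P]_w (expR (th * (ln (engel_digit (X w) n)%:R - n%:R)))%:E)%E.
  apply: eq_integral => w _; congr (expR _)%:E; rewrite /th /r; field.
  by rewrite !gt_eqF.
have nth3 : n%:R * (2 * `|th| ^+ 3) = a n ^+ 2 * (2 * t ^+ 2 * `|th|).
  rewrite exprS real_normK ?num_real//.
  have -> : n%:R * (2 * (`|th| * th ^+ 2)) = 2 * `|th| * (n%:R * th ^+ 2).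
    by ring.
  by rewrite nth; ring.
have /andP[lo up] := engel_log_mgf hX th1 n0.
apply/andP; split.
- apply: le_trans lo; rewrite lee_fin ler_expR; nra.
- apply: le_trans up _; rewrite lee_fin ler_expR; nra.
Unshelve. all: by end_near. Qed.
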